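(* Let $k \geq 0$ be an integer. For each positive integer $d$, let $C_1(k,d)$ be the sharp constant in the inequality $$\sum_{n \in \mathbb{Z}^d} |D(\Delta^k u)(n)|^2 \geq C_1(k, d) \sum_{n \in \mathbb{Z}^d} \frac{|u(n)|^2}{|n|^{4k+2}},\qquad u \in C_c(\mathbb{Z}^d),\ u(0)=0,$$ i.e. the largest constant for which this inequality holds for all $u\in C_c(\mathbb{Z}^d)$ with $u(0)=0$. Then $C_1(k, d) \sim d^{2k+1}$ as $d \to \infty$; that is, there exist positive constants $c_1, c_2$ and $N$, independent of $d$, such that $c_1 d^{2k+1}\leq C_1(k,d) \leq c_2 d^{2k+1}$ for all $d\geq N$.
   Context: $C_c(\mathbb{Z}^d)$ denotes the space of finitely supported (complex-valued) functions on $\mathbb{Z}^d$; $|n|$ is the Euclidean norm of $n \in \mathbb{Z}^d$; $e_j$ is the $j$-th canonical basis vector of $\mathbb{R}^d$. For $u:\mathbb{Z}^d\to\mathbb{C}$, $D_j u(n) := u(n)-u(n-e_j)$, $Du(n) := (D_1u(n),\dots,D_du(n))$, $|Du(n)|^2=\sum_{j=1}^d |D_ju(n)|^2$, and the discrete Laplacian is $\Delta u(n) := \sum_{j=1}^d \big(2u(n)-u(n-e_j)-u(n+e_j)\big)$; $\Delta^k$ is its $k$-fold composition ($\Delta^0$ is the identity). Since $u(0)=0$, the term $n=0$ in the sum weighted by a negative power of $|n|$ is understood to be $0$. *)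

(* Defs.v *)
From mathcomp Require Import all_boot all_order all_algebra complex.
From mathcomp Require Import boolp classical_sets cardinality fsbigop reals.

Set Implicit Arguments.
Unset Strict Implicit.
Unset Printing Implicit Defensive.

Import Order.TTheory GRing.Theory Num.Theory.
Import ComplexField.Normc.

Local Open Scope classical_set_scope.
Local Open Scope ring_scope.

Notation lattice d := 'rV[int]_d.

Definition basis_vec (d : nat) (j : 'I_d) : lattice d := delta_mx 0 j.

Definition eucl_norm (R : realType) (d : nat) (n : lattice d) : R :=
  Num.sqrt (\sum_(j < d) (n 0 j)%:~R ^+ 2).

Definition fin_supp (R : realType) (d : nat) (u : lattice d -> R[i]) : Prop :=
  finite_set [set n | u n != 0].

Definition backward_diff (R : realType) (d : nat) (j : 'I_d) (u : lattice d -> R[i]) :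
    lattice d -> R[i] :=
  fun n => u n - u (n - basis_vec j).

Definition sqnorm_grad (R : realType) (d : nat) (u : lattice d -> R[i])
    (n : lattice d) : R :=
  \sum_(j < d) normc (backward_diff j u n) ^+ 2.

(* The nonnegative Laplacian: the opposite of the usual sign convention. *)
Definition laplacian (R : realType) (d : nat) (u : lattice d -> R[i]) :
    lattice d -> R[i] :=
  fun n => \sum_(j < d) (u n *+ 2 - u (n - basis_vec j) - u (n + basis_vec j)).

(* [\sum_(n \in setT)] is the sum over the support of the summand when that
   support is finite; fin_supp_energy and fin_supp_weighted below show that it
   is for fin_supp u. *)
Definition energy (R : realType) (k d : nat) (u : lattice d -> R[i]) : R :=
  \sum_(n \in [set: lattice d]) sqnorm_grad (iter k (@laplacian R d) u) n.

(* The term n = 0 vanishes because 0^-1 = 0. *)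
Definition weighted_sum (R : realType) (k d : nat) (u : lattice d -> R[i]) : R :=
  \sum_(n \in [set: lattice d])
    normc (u n) ^+ 2 / eucl_norm R n ^+ (4 * k + 2)%N.

Definition admissible (R : realType) (k d : nat) (c : R) : Prop :=
  forall u : lattice d -> R[i], fin_supp u -> u 0 = 0 ->
    c * weighted_sum k u <= energy k u.

(* For 0 < d this supremum is a maximum: see sharp_constant_max. *)
Definition sharp_constant (R : realType) (k d : nat) : R :=
  sup [set c : R | admissible k d c].

Lemma fin_supp_shift (R : realType) (d : nat) (u : lattice d -> R[i])
    (v : lattice d) : fin_supp u -> fin_supp (fun n => u (n + v)).
Proof.
move=> fu; apply: (sub_finite_set _ (finite_image (fun n => n - v) fu)).
by move=> n /= un; exists (n + v); rewrite ?addrK.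
Qed.

Lemma fin_supp_sub (R : realType) (d : nat) (u v : lattice d -> R[i]) :
  fin_supp u -> fin_supp v -> fin_supp (fun n => u n - v n).
Proof.
move=> fu fv; have fuv : finite_set ([set n | u n != 0] `|` [set n | v n != 0]).
  by rewrite finite_setU.
apply: (sub_finite_set _ fuv) => n /=.
by have [->|?] := eqVneq (u n) 0; [rewrite sub0r oppr_eq0; right | left].
Qed.

Lemma fin_supp_backward_diff (R : realType) (d : nat) (j : 'I_d)
    (u : lattice d -> R[i]) : fin_supp u -> fin_supp (backward_diff j u).
Proof.
by move=> fu; apply: fin_supp_sub => //; exact: (fin_supp_shift (- _) fu).
Qed.

Lemma fin_supp_sum (R : realType) (d m : nat)
    (u : 'I_m -> lattice d -> R[i]) :
  (forall j, fin_supp (u j)) -> fin_supp (fun n => \sum_(j < m) u j n).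
Proof.
elim: m u => [|m IH] u fu.
  apply: (sub_finite_set _ (@finite_set0 _)) => n /=.
  by rewrite big_ord0 eqxx.
have f1 : fin_supp (fun n => - \sum_(j < m) u (widen_ord (leqnSn m) j) n).
  have := IH (fun j => u (widen_ord (leqnSn m) j)) (fun j => fu _).
  by apply: sub_finite_set => n /=; rewrite oppr_eq0.
have := fin_supp_sub (fu ord_max) f1.
by apply: sub_finite_set => n /=; rewrite big_ord_recr /= opprK addrC.
Qed.

Lemma fin_supp_laplacian (R : realType) (d : nat) (u : lattice d -> R[i]) :
  fin_supp u -> fin_supp (laplacian u).
Proof.
move=> fu; apply: fin_supp_sum => j.
apply: fin_supp_sub; last exact: fin_supp_shift.
apply: fin_supp_sub; last exact: (fin_supp_shift (- _) fu).
apply: (sub_finite_set _ fu) => n /=.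
by apply: contraNN => /eqP->; rewrite mul0rn.
Qed.

Lemma fin_supp_iter_laplacian (R : realType) (k d : nat)
    (u : lattice d -> R[i]) :
  fin_supp u -> fin_supp (iter k (@laplacian R d) u).
Proof. by move=> fu; elim: k => //= k; exact: fin_supp_laplacian. Qed.

Lemma fin_supp_energy (R : realType) (k d : nat) (u : lattice d -> R[i]) :
  fin_supp u ->
  finite_set [set n | sqnorm_grad (iter k (@laplacian R d) u) n != 0].
Proof.
move=> fu; pose w := iter k (@laplacian R d) u.
have fw : finite_set (\bigcup_(j in [set: 'I_d]) [set n | backward_diff j w n != 0]).
  apply: bigcup_finite => // j _.
  exact/fin_supp_backward_diff/fin_supp_iter_laplacian.
apply: (sub_finite_set _ fw) => n /=; rewrite /sqnorm_grad => sn.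
apply: contrapT => h; case/eqP: sn; apply: big1 => j _.
have [->|dj] := eqVneq (backward_diff j w n) 0; first by rewrite normc0 expr0n.
by case: h; exists j.
Qed.

Lemma fin_supp_weighted (R : realType) (k d : nat) (u : lattice d -> R[i]) :
  fin_supp u ->
  finite_set
    [set n | normc (u n) ^+ 2 / eucl_norm R n ^+ (4 * k + 2)%N != 0].
Proof.
apply: sub_finite_set => n /=; apply: contraNN => /eqP->.
by rewrite normc0 expr0n mul0r.
Qed.

Lemma energy_ge0 (R : realType) (k d : nat) (u : lattice d -> R[i]) :
  0 <= energy k u.
Proof. by apply: fsumr_ge0 => n _; apply: sumr_ge0 => j _; exact: sqr_ge0. Qed.

Lemma weighted_sum_ge0 (R : realType) (k d : nat) (u : lattice d -> R[i]) :
  0 <= weighted_sum k u.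
Proof.
apply: fsumr_ge0 => n _.
by rewrite mulr_ge0 ?sqr_ge0// invr_ge0 exprn_ge0// sqrtr_ge0.
Qed.

Lemma admissible0 (R : realType) (k d : nat) : admissible k d (0 : R).
Proof. by move=> u _ _; rewrite mul0r energy_ge0. Qed.

Lemma weighted_sum_delta (R : realType) (k d : nat) (j : 'I_d) :
  weighted_sum k (fun n => (n == basis_vec j)%:R : R[i]) = 1.
Proof.
rewrite /weighted_sum -(fsbig_widen [set basis_vec j] setT)//=; last first.
  move=> n [_ /= /eqP/negbTE ->].
  by rewrite normc0 expr0n mul0r.
rewrite fsbig_set1 eqxx normc1 expr1n div1r /eucl_norm (bigD1 j)//= big1.
  by rewrite !mxE !eqxx addr0 expr1n sqrtr1 expr1n invr1.
by move=> i ij; rewrite !mxE (negbTE ij) andbF expr0n.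
Qed.

Lemma admissible_has_sup (R : realType) (k d : nat) : (0 < d)%N ->
  has_sup [set c : R | admissible k d c].
Proof.
move=> d0; split; first by exists 0; exact: admissible0.
pose j := Ordinal d0; pose u := fun n : lattice d => (n == basis_vec j)%:R : R[i].
exists (energy k u) => c /= /(_ u).
rewrite weighted_sum_delta mulr1; apply.
- apply: (sub_finite_set _ (finite_set1 (basis_vec j))) => n /=.
  by rewrite /u; case: (n =P basis_vec j) => // _; rewrite eqxx.
- rewrite /u; case: (0 =P basis_vec j) => // /matrixP/(_ 0 j).
  by rewrite !mxE !eqxx.
Qed.

Lemma sharp_constant_max (R : realType) (k d : nat) : (0 < d)%N ->
  admissible k d (sharp_constant R k d) /\
  (forall c : R, admissible k d c -> c <= sharp_constant R k d).
Proof.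
move=> d0; have hs := @admissible_has_sup R k d d0.
split; last by move=> c ac; apply: (sup_upper_bound hs).
move=> u fu u0; have := weighted_sum_ge0 k u; rewrite le_eqVlt.
move=> /predU1P[<-|w0]; first by rewrite mulr0 energy_ge0.
rewrite -ler_pdivlMr//; apply: ge_sup; first exact: hs.1.
by move=> c /= ac; rewrite ler_pdivlMr//; exact: ac.
Qed.

(* Main.v *)
Require Import Defs.
From mathcomp Require Import all_boot all_order all_algebra complex.
From mathcomp Require Import boolp classical_sets cardinality fsbigop reals.
From mathcomp Require Import finmap zify ring lra.

(** Everything reduces to real-valued functions, because the energy and the
weighted sum both split over real and imaginary parts.

The upper bound is the energy of the unit mass at a neighbour of the origin,
whose weighted sum is 1: the Dirichlet form is at most 4 d times the squared
l^2 norm, and each Laplacian costs at most a factor (4 d)^2.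

For the lower bound, put w n = 1 / (A + |n|^2) for a large constant A depending
only on k.  In high dimension the powers of w are superharmonic in a
quantitative way: for 1 <= b <= 2 k + 1 and d large,

  Delta (w^b) >= (d / 2) w^(b+1)     at every lattice point, the origin included

(laplacian_weight_ge; Delta is the nonnegative Laplacian).  The reason is that
the second differences of w^b in the d directions are each about
2 b w^(b+1), with quadratic errors that either carry an additional factor
w <= 1/A or involve the squared coordinates of n, whose sum over all directions
is at most 1 / w and so does not grow with d.

Two inequalities follow, both without any vanishing condition at 0:

- Hardy (hardy): with w as a ground state,
    sum |D f|^2 >= sum f^2 (Delta w) / w >= (d / 2) sum f^2 w;
- weighted Rellich (weighted_rellich): the identity
    sum Delta (f^2) w^(b+1) = sum f^2 Delta (w^(b+1)),
  the pointwise bound Delta (f^2) <= 2 f Delta f and the inequality of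
  arithmetic and geometric means give
    sum (Delta f)^2 w^b >= (d^2 / 16) sum f^2 w^(b+2).

The absence of a condition at 0 is what allows the iteration, since Delta^j u
need not vanish at 0 even though u does.  Hardy for Delta^k u, followed by k
applications of Rellich with b = 1, 3, ..., 2 k - 1, bounds the energy below by
a multiple of d^(2 k + 1) times the sum of |u|^2 w^(2 k + 1).  Only then is
u 0 = 0 used: for n <> 0 one has |n| >= 1, so w n is at least
1 / ((1 + A) |n|^2). *)

Set Implicit Arguments.
Unset Strict Implicit.
Unset Printing Implicit Defensive.

Import Order.TTheory GRing.Theory Num.Theory.
Import ComplexField.Normc.

Local Open Scope classical_set_scope.
Local Open Scope ring_scope.

(** * Real functions on the lattice *)

Definition finitely_supported (R : realType) (d : nat) (f : lattice d -> R) :=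
  finite_set [set n | f n != 0].

Definition lattice_sum (R : realType) (d : nat) (f : lattice d -> R) : R :=
  \sum_(n \in [set: lattice d]) f n.

Definition real_laplacian (R : realType) (d : nat) (f : lattice d -> R) :
    lattice d -> R :=
  fun n => \sum_(j < d) (f n *+ 2 - f (n - basis_vec j) - f (n + basis_vec j)).

Definition dirichlet_form (R : realType) (d : nat) (f : lattice d -> R) : R :=
  lattice_sum (fun n => \sum_(j < d) (f n - f (n - basis_vec j)) ^+ 2).

Definition inv_weight (R : realType) (d : nat) (A : R) (n : lattice d) : R :=
  (A + \sum_(j < d) (n 0 j)%:~R ^+ 2)^-1.

(** * Sums over the lattice *)

Section LatticeSums.
Variables (R : realType) (d : nat).
Implicit Types f g : lattice d -> R.

Lemma finitely_supported_dom f g : finitely_supported f ->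
  (forall n, f n = 0 -> g n = 0) -> finitely_supported g.
Proof.
move=> ff fg; apply: (sub_finite_set _ ff) => n /=.
by apply: contraNN => /eqP/fg->.
Qed.

Lemma finitely_supportedM f g : finitely_supported f ->
  finitely_supported (fun n => f n * g n).
Proof. by move=> /finitely_supported_dom; apply=> n ->; rewrite mul0r. Qed.

Lemma finitely_supportedX f p : finitely_supported f ->
  finitely_supported (fun n => f n ^+ p.+1).
Proof. by move=> /finitely_supported_dom; apply=> n ->; rewrite expr0n. Qed.

Lemma finitely_supportedZ a f : finitely_supported f ->
  finitely_supported (fun n => a * f n).
Proof. by move=> /finitely_supported_dom; apply=> n ->; rewrite mulr0. Qed.

Lemma finitely_supportedD f g : finitely_supported f -> finitely_supported g ->
  finitely_supported (fun n => f n + g n).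
Proof.
move=> ff fg; have ffg : finite_set ([set n | f n != 0] `|` [set n | g n != 0]).
  by rewrite finite_setU.
apply: (sub_finite_set _ ffg) => n /=.
by have [->|?] := eqVneq (f n) 0; [rewrite add0r; right | left].
Qed.

Lemma finitely_supported_shift f v : finitely_supported f ->
  finitely_supported (fun n => f (n + v)).
Proof.
move=> ff; apply: (sub_finite_set _ (finite_image (fun n => n - v) ff)).
by move=> n /= fn; exists (n + v); rewrite ?addrK.
Qed.

Lemma finitely_supportedN f : finitely_supported f ->
  finitely_supported (fun n => - f n).
Proof. by move=> /finitely_supported_dom; apply=> n ->; rewrite oppr0. Qed.

Lemma finitely_supported_sum (m : nat) (F : 'I_m -> lattice d -> R) :
  (forall j, finitely_supported (F j)) ->
  finitely_supported (fun n => \sum_(j < m) F j n).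
Proof.
elim: m F => [|m IH] F fF.
  apply: (sub_finite_set _ (@finite_set0 _)) => n /=.
  by rewrite big_ord0 eqxx.
have := finitely_supportedD (IH _ (fun j => fF (widen_ord (leqnSn m) j)))
  (fF ord_max).
by apply: sub_finite_set => n /=; rewrite big_ord_recr.
Qed.

Lemma lattice_sumE (s : {fset lattice d}) f :
  (forall n, n \notin s -> f n = 0) -> lattice_sum f = \sum_(n <- s) f n.
Proof. exact: fsbigTE. Qed.

Lemma finitely_supportedP f : finitely_supported f ->
  exists s : {fset lattice d}, forall n, n \notin s -> f n = 0.
Proof.
move=> ff; exists (fset_set [set n | f n != 0]) => n.
rewrite in_fset_set// => /negP nf; apply/eqP; apply: contrapT => /negP fn.
by apply: nf; rewrite mem_setE.
Qed.

Lemma lattice_sumD f g : finitely_supported f -> finitely_supported g ->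
  lattice_sum (fun n => f n + g n) = lattice_sum f + lattice_sum g.
Proof.
move=> /finitely_supportedP[s fs] /finitely_supportedP[t gt].
have fs0 n : n \notin (s `|` t)%fset -> f n = 0.
  by rewrite in_fsetU negb_or => /andP[/fs].
have gt0 n : n \notin (s `|` t)%fset -> g n = 0.
  by rewrite in_fsetU negb_or => /andP[_ /gt].
rewrite (lattice_sumE fs0) (lattice_sumE gt0) (@lattice_sumE (s `|` t)%fset).
  by rewrite big_split.
by move=> n nst; rewrite fs0// gt0// addr0.
Qed.

Lemma lattice_sumZ a f : lattice_sum (fun n => a * f n) = a * lattice_sum f.
Proof. by rewrite /lattice_sum mulr_fsumr. Qed.

Lemma lattice_sumN f : lattice_sum (fun n => - f n) = - lattice_sum f.
Proof.
by rewrite -mulN1r -lattice_sumZ; congr lattice_sum; apply/funext => n;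
  rewrite mulN1r.
Qed.

Lemma eq_lattice_sum f g : f =1 g -> lattice_sum f = lattice_sum g.
Proof. by move=> /funext->. Qed.

Lemma lattice_sum_shift f v : lattice_sum (fun n => f (n + v)) = lattice_sum f.
Proof.
rewrite /lattice_sum [RHS](reindex_fsbigT (fun n => n + v))//.
by exists (fun n => n - v) => n; rewrite ?addrK ?subrK.
Qed.

Lemma lattice_sum_sum (m : nat) (F : 'I_m -> lattice d -> R) :
  (forall j, finitely_supported (F j)) ->
  lattice_sum (fun n => \sum_(j < m) F j n) = \sum_(j < m) lattice_sum (F j).
Proof.
elim: m F => [|m IH] F fF.
  by rewrite big_ord0 /lattice_sum fsbig1// => n _; rewrite big_ord0.
rewrite big_ord_recr/= -IH// -lattice_sumD//; last exact: finitely_supported_sum.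
by apply: eq_lattice_sum => n; rewrite big_ord_recr.
Qed.

Lemma le_lattice_sum f g : finitely_supported f -> finitely_supported g ->
  (forall n, f n <= g n) -> lattice_sum f <= lattice_sum g.
Proof.
move=> ff fg fleg; rewrite -subr_ge0 -lattice_sumN -lattice_sumD//.
  by apply: fsumr_ge0 => n _; rewrite subr_ge0.
exact: finitely_supportedN.
Qed.

End LatticeSums.

(** * Summation by parts and unweighted estimates *)

Section Calculus.
Variables (R : realType) (d : nat).
Implicit Types f g : lattice d -> R.

Lemma finitely_supported_divergence (h : 'I_d -> lattice d -> R) :
  (forall j, finitely_supported (h j)) ->
  finitely_supported (fun n => \sum_(j < d) (h j n - h j (n + basis_vec j))).
Proof.
move=> fh; apply: finitely_supported_sum => j; apply: finitely_supportedD => //.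
exact/finitely_supportedN/finitely_supported_shift.
Qed.

Lemma lattice_sum_divergence (h : 'I_d -> lattice d -> R) :
  (forall j, finitely_supported (h j)) ->
  lattice_sum (fun n => \sum_(j < d) (h j n - h j (n + basis_vec j))) = 0.
Proof.
move=> fh.
have fNh j : finitely_supported (fun n => - h j (n + basis_vec j)).
  exact/finitely_supportedN/finitely_supported_shift.
rewrite lattice_sum_sum => [|j]; last exact: finitely_supportedD.
apply: big1 => j _.
by rewrite lattice_sumD// lattice_sumN lattice_sum_shift subrr.
Qed.

(** Energy estimates thus reduce to inequalities at a single lattice point, up
to a discrete divergence that reassigns each edge term to the other endpoint
of the edge. *)
Lemma le_lattice_sum_divergence f g (h : 'I_d -> lattice d -> R) :
  finitely_supported f -> finitely_supported g ->
  (forall j, finitely_supported (h j)) ->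
  (forall n, f n + \sum_(j < d) (h j n - h j (n + basis_vec j)) <= g n) ->
  lattice_sum f <= lattice_sum g.
Proof.
move=> ff fg fh le_fg; have fdiv := finitely_supported_divergence fh.
rewrite -[leLHS]addr0 -(lattice_sum_divergence fh) -lattice_sumD//.
by apply: le_lattice_sum => //; exact: finitely_supportedD.
Qed.

Lemma finitely_supported_laplacian f :
  finitely_supported f -> finitely_supported (real_laplacian f).
Proof.
move=> ff; apply: finitely_supported_sum => j.
have fN v : finitely_supported (fun n => - f (n + v)).
  exact/finitely_supportedN/finitely_supported_shift.
do 2![apply: finitely_supportedD => //].
by apply: (finitely_supported_dom ff) => n ->; rewrite mul0rn.
Qed.

Lemma finitely_supported_iter_laplacian k f : finitely_supported f ->
  finitely_supported (iter k (@real_laplacian R d) f).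
Proof. by move=> ff; elim: k => //= k; exact: finitely_supported_laplacian. Qed.

Lemma finitely_supported_gradient f : finitely_supported f ->
  finitely_supported (fun n => \sum_(j < d) (f n - f (n - basis_vec j)) ^+ 2).
Proof.
move=> ff; apply: finitely_supported_sum => j; apply: finitely_supportedX.
apply: finitely_supportedD => //.
exact: (finitely_supportedN (finitely_supported_shift (- basis_vec j) ff)).
Qed.

Lemma lattice_sum_laplacianC f g : finitely_supported f ->
  lattice_sum (fun n => real_laplacian f n * g n) =
  lattice_sum (fun n => f n * real_laplacian g n).
Proof.
move=> ff.
pose h j n := f n * g (n - basis_vec j) - f (n - basis_vec j) * g n.
have fh j : finitely_supported (h j).
  apply: finitely_supportedD; first exact: finitely_supportedM.
  apply: (finitely_supported_dom (finitely_supported_shift (- basis_vec j) ff)).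
  by move=> n ->; rewrite mul0r oppr0.
rewrite -[RHS]addr0 -(lattice_sum_divergence fh) -lattice_sumD; last first.
- exact: finitely_supported_divergence.
- exact: finitely_supportedM.
apply: eq_lattice_sum => n.
rewrite /real_laplacian mulr_suml mulr_sumr -big_split; apply: eq_bigr => j _.
rewrite /h addrK/=; ring.
Qed.

(** The difference of the two sides is the sum of the squared differences
between [f n] and its values at the neighbours of [n]. *)
Lemma laplacian_sqr_le f n :
  real_laplacian (fun m => f m ^+ 2) n <= 2 * (f n * real_laplacian f n).
Proof.
rewrite /real_laplacian !mulr_sumr; apply: ler_sum => j _.
set a := f n; set b := f (n - _); set c := f (n + _).
rewrite -subr_ge0 (_ : _ - _ = (a - b) ^+ 2 + (a - c) ^+ 2); last by ring.
by rewrite addr_ge0 ?sqr_ge0.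
Qed.

(** On an edge from x to y, the arithmetic-geometric mean inequality bounds
2 f(x) f(y) by f(x)^2 phi(y) / phi(x) + f(y)^2 phi(x) / phi(y); summing over
the edges collects (Delta phi / phi)(x) in front of f(x)^2. *)
Lemma hardy_ground_state (phi : lattice d -> R) f : finitely_supported f ->
  (forall n, 0 < phi n) ->
  lattice_sum (fun n => f n ^+ 2 * (real_laplacian phi n / phi n)) <=
  dirichlet_form f.
Proof.
move=> ff phi_gt0.
(* The share of the edge (n - e_j, n) that belongs to the endpoint n - e_j. *)
pose h j n := f (n - basis_vec j) ^+ 2 * (1 - phi n / phi (n - basis_vec j)).
apply: (le_lattice_sum_divergence (h := h)).
- exact/finitely_supportedM/finitely_supportedX.
- exact: finitely_supported_gradient.
- move=> j.
  apply: (finitely_supported_dom (finitely_supported_shift (- basis_vec j) ff)).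
  by move=> n fn; rewrite /h fn expr0n mul0r.
move=> n; rewrite /real_laplacian mulr_suml mulr_sumr -big_split.
apply: ler_sum => j _; rewrite /h addrK/=.
have := phi_gt0 n; have := phi_gt0 (n - basis_vec j).
set a := f n; set b := f (n - _).
set x := phi n; set y := phi (n - _); set z := phi (n + _) => y0 x0.
rewrite -subr_ge0 (_ : _ - _ = x * y * (a / x - b / y) ^+ 2).
  by rewrite mulr_ge0 ?sqr_ge0// mulr_ge0// ltW.
by field; rewrite !gt_eqF.
Qed.

Lemma sqr_sum_le (m : nat) (x : 'I_m -> R) :
  (\sum_(j < m) x j) ^+ 2 <= m%:R * \sum_(j < m) x j ^+ 2.
Proof.
rewrite expr2 big_distrlr/=.
have le_prod i j : x i * x j <= 2^-1 * x i ^+ 2 + 2^-1 * x j ^+ 2.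
  by have := sqr_ge0 (x i - x j); nra.
apply: le_trans (ler_sum _ (fun i _ => ler_sum _ (fun j _ => le_prod i j))) _.
rewrite (eq_bigr (fun i => m%:R * (2^-1 * x i ^+ 2)
    + 2^-1 * \sum_(j < m) x j ^+ 2)) => [|i _]; last first.
  by rewrite big_split/= sumr_const card_ord mulr_natl mulr_sumr.
rewrite big_split/= sumr_const card_ord -!mulr_sumr -[_ *+ m]mulr_natl.
by lra.
Qed.

Lemma dirichlet_form_le f : finitely_supported f ->
  dirichlet_form f <= 4 * d%:R * lattice_sum (fun n => f n ^+ 2).
Proof.
move=> ff; rewrite -lattice_sumZ.
(* Moves the squares at the neighbours n - e_j back to n. *)
pose h j n := - (2 * f (n - @basis_vec d j) ^+ 2).
apply: (le_lattice_sum_divergence (h := h)).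
- exact: finitely_supported_gradient.
- exact/finitely_supportedZ/finitely_supportedX.
- move=> j.
  apply: (finitely_supported_dom (finitely_supported_shift (- basis_vec j) ff)).
  by move=> n fn; rewrite /h fn expr0n mulr0 oppr0.
move=> n; rewrite -big_split/=.
have -> : 4 * d%:R * f n ^+ 2 = \sum_(j < d) (4 * f n ^+ 2).
  by rewrite sumr_const card_ord -[_ *+ d]mulr_natl; ring.
apply: ler_sum => j _; rewrite /h addrK.
by have := sqr_ge0 (f n + f (n - basis_vec j)); nra.
Qed.

Lemma lattice_sum_laplacian_sqr_le f : finitely_supported f ->
  lattice_sum (fun n => real_laplacian f n ^+ 2) <=
  16 * d%:R ^+ 2 * lattice_sum (fun n => f n ^+ 2).
Proof.
move=> ff; rewrite -lattice_sumZ.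
(* With the divergence of this h, the squares at the neighbours in the bound
   (2 a - b - c)^2 <= 4 (2 a^2 + b^2 + c^2) all become squares at n. *)
pose h j n := - (4 * d%:R * (f (n - @basis_vec d j) ^+ 2 - f n ^+ 2)).
apply: (le_lattice_sum_divergence (h := h)).
- exact/finitely_supportedX/finitely_supported_laplacian.
- exact/finitely_supportedZ/finitely_supportedX.
- move=> j.
  have fsh := finitely_supported_shift (- basis_vec j) ff.
  apply/finitely_supportedN/finitely_supportedZ/finitely_supportedD.
    exact: (finitely_supportedX 1 fsh).
  exact/finitely_supportedN/finitely_supportedX.
move=> n; apply: le_trans (lerD (sqr_sum_le _) (lexx _)) _.
rewrite mulr_sumr -big_split/=.
have -> : 16 * d%:R ^+ 2 * f n ^+ 2 = \sum_(j < d) (16 * d%:R * f n ^+ 2).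
  by rewrite sumr_const card_ord -[_ *+ d]mulr_natl; ring.
apply: ler_sum => j _; rewrite /h addrK.
set a := f n; set b := f (n - _); set c := f (n + _).
have d0 : 0 <= d%:R :> R by [].
rewrite -subr_ge0.
rewrite (_ : _ - _ = d%:R * (2 * (a + b) ^+ 2 + 2 * (a + c) ^+ 2 + (b - c) ^+ 2)).
  apply: mulr_ge0 => //.
  have := sqr_ge0 (a + b); have := sqr_ge0 (a + c); have := sqr_ge0 (b - c).
  by lra.
ring.
Qed.

End Calculus.

(** * Superharmonicity of the weights *)

Section Weight.
Variables (R : realType) (d : nat) (A : R).
Hypothesis A_ge1 : 1 <= A.
Implicit Types (f : lattice d -> R) (n : lattice d).
Let w := inv_weight (d := d) A.

Lemma sum_coord_sqr_ge0 n : 0 <= \sum_(j < d) (n 0 j)%:~R ^+ 2 :> R.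
Proof. by apply: sumr_ge0 => j _; exact: sqr_ge0. Qed.

Lemma inv_weight_gt0 n : 0 < w n.
Proof. by rewrite invr_gt0 ltr_pwDl ?sum_coord_sqr_ge0// (lt_le_trans ltr01). Qed.

Lemma inv_weight_leV n : w n <= A^-1.
Proof.
have A0 : 0 < A by rewrite (lt_le_trans ltr01).
rewrite lef_pV2 ?posrE ?lerDl ?sum_coord_sqr_ge0//.
by rewrite ltr_pwDl ?sum_coord_sqr_ge0.
Qed.

Lemma inv_weight_shift n (j : 'I_d) (e : R) (v : lattice d) :
  (forall i, (v 0 i)%:~R = e *+ (i == j) :> R) -> e ^+ 2 = 1 ->
  (inv_weight A (n + v))^-1 = (w n)^-1 + 1 + 2 * (e * (n 0 j)%:~R).
Proof.
move=> vE e1; rewrite /w /inv_weight !invrK (bigD1 j)//= [in RHS](bigD1 j)//=.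
have -> : \sum_(i < d | i != j) ((n + v) 0 i)%:~R ^+ 2 =
    \sum_(i < d | i != j) (n 0 i)%:~R ^+ 2 :> R.
  by apply: eq_bigr => i ij; rewrite mxE intrD vE (negbTE ij) mulr0n addr0.
by rewrite mxE intrD vE eqxx mulr1n sqrrD e1; ring.
Qed.

Lemma inv_weight_fwd n (j : 'I_d) :
  inv_weight A (n + basis_vec j) = ((w n)^-1 + 1 + 2 * (n 0 j)%:~R)^-1.
Proof.
rewrite -[LHS]invrK (@inv_weight_shift _ j 1) ?expr1n ?mul1r// => i.
by rewrite !mxE eqxx/= eq_sym; case: (j == i).
Qed.

Lemma inv_weight_bwd n (j : 'I_d) :
  inv_weight A (n - basis_vec j) = ((w n)^-1 + 1 - 2 * (n 0 j)%:~R)^-1.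
Proof.
rewrite -[LHS]invrK (@inv_weight_shift _ j (-1)) ?sqrrN ?expr1n//.
  by rewrite mulN1r mulrN.
by move=> i; rewrite !mxE eqxx/= eq_sym; case: (j == i).
Qed.

(** This keeps the relative step (1 +- 2 n_j) w of 1/w above -2/3, within the
range of [expr_inv_upper]. *)
Lemma coord_sqr_le n (j : 'I_d) : 1 + (n 0 j)%:~R ^+ 2 <= (w n)^-1.
Proof.
rewrite /w /inv_weight invrK (bigD1 j)//= lerD// lerDl.
by apply: sumr_ge0 => i _; exact: sqr_ge0.
Qed.

End Weight.

(** A second-order Taylor bound with a uniform remainder away from the pole at
-1, by induction on [b]: each factor (1 + t)^-1 is at most 3 and equals
1 - t (1 + t)^-1.  The base 6 serves the inductive step, which needs
3 (b + 1) + 3 b 6^b <= (b + 1) 6^(b + 1). *)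
Lemma expr_inv_upper (R : realType) (b : nat) (t : R) : - (2 / 3) <= t ->
  (1 + t)^-1 ^+ b <= 1 - b%:R * t + b%:R * 6 ^+ b * t ^+ 2.
Proof.
move=> t_ge; set q := (1 + t)^-1.
have qE : (1 + t) * q = 1 by rewrite mulfV//; lra.
have q0 : 0 < q by rewrite invr_gt0; lra.
have q3 : q <= 3.
  rewrite -[leRHS]invrK lef_pV2 ?posrE ?invr_gt0//; lra.
elim: b => [|b IH]; first by rewrite expr0; lra.
rewrite exprS.
apply: le_trans (ler_wpM2l (ltW q0) IH) _.
have t2 := sqr_ge0 t.
have P0 : 1 <= 6 ^+ b :> R by rewrite exprn_ege1//; lra.
have b0 : 0 <= b%:R :> R by [].
rewrite -[b.+1%:R]natr1 [6 ^+ b.+1]exprS; move: P0 b0; set P := 6 ^+ b; set c := b%:R => P0 b0.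
have -> : q * (1 - c * t + c * P * t ^+ 2) =
    1 - (c + 1) * t + ((c + 1) + c * P) * (q * t ^+ 2).
  have tq : t * q = 1 - q by lra.
  have ttq : t ^+ 2 * q = t - 1 + q by rewrite expr2 -mulrA tq; lra.
  transitivity (q - c * (t * q) + c * P * (q * t ^+ 2)); first by ring.
  rewrite tq mulrDl [q * t ^+ 2]mulrC ttq; ring.
rewrite lerD2l.
have cP : 0 <= c * P by rewrite mulr_ge0//; lra.
apply: le_trans (_ : (c + 1 + c * P) * (3 * t ^+ 2) <= _).
  by apply: ler_wpM2l; [rewrite !addr_ge0 | exact: ler_wpM2r].
rewrite mulrA; apply: ler_wpM2r => //; nra.
Qed.

Section Superharmonic.
Variables (R : realType) (d : nat) (A : R) (b : nat).
Hypotheses (b_gt0 : (0 < b)%N) (A_ge : 2 * 6 ^+ b <= A).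
Hypothesis d_ge : 16 * 6 ^+ b <= d%:R :> R.
Let w := inv_weight (d := d) A.

Let P1 : 1 <= 6 ^+ b :> R. Proof. by rewrite exprn_ege1//; lra. Qed.
Let A_ge1 : 1 <= A.
Proof. by move: P1 A_ge; set P := 6 ^+ b => h1 h2; lra. Qed.

(** With t = (1 +- 2 n_j) w n, the neighbouring values of w are w n / (1 + t).
In the two Taylor bounds the odd terms +-2 n_j cancel, leaving
2 b w n, relative to (w n)^b, as the first-order part. *)
Lemma second_difference_weight (j : 'I_d) (n : lattice d) :
  w n ^+ b.+1 * (2 * b%:R - b%:R * 6 ^+ b * (2 + 8 * (n 0 j)%:~R ^+ 2) * w n) <=
  w n ^+ b *+ 2 - w (n - basis_vec j) ^+ b - w (n + basis_vec j) ^+ b.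
Proof.
rewrite /w inv_weight_bwd inv_weight_fwd -/w.
have w0 : 0 < w n := inv_weight_gt0 A_ge1 n.
have := coord_sqr_le A_ge1 n j; rewrite -/w.
set x := w n in w0 *; set m : R := (n 0 j)%:~R => s_ge.
have s0 : 0 < x^-1 by rewrite invr_gt0.
have key (e : R) : e ^+ 2 = 1 -> (x^-1 + 1 + 2 * (e * m))^-1 ^+ b <=
    x ^+ b * (1 - b%:R * (x * (1 + 2 * (e * m)))
              + b%:R * 6 ^+ b * (x * (1 + 2 * (e * m))) ^+ 2).
  move=> e1; have em : (e * m) ^+ 2 = m ^+ 2 by rewrite exprMn e1 mul1r.
  set t := x * (1 + 2 * (e * m)).
  have -> : x^-1 + 1 + 2 * (e * m) = x^-1 * (1 + t).
    by rewrite mulrDr mulr1 /t mulKf ?gt_eqF// addrA.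
  rewrite invfM invrK exprMn; apply: ler_wpM2l; first by rewrite exprn_ge0 ?ltW.
  apply: expr_inv_upper.
  (* t >= -2/3, multiplied by 3 / x *)
  have : 0 <= 2 * x^-1 + 3 * (1 + 2 * (e * m)).
    by have := sqr_ge0 (e * m + 3 / 2); nra.
  move=> /(mulr_ge0 (ltW w0)); rewrite mulrDr mulrCA mulfV ?gt_eqF// /t.
  by lra.
have := key 1; have := key (-1); rewrite !mul1r mulN1r sqrrN expr1n mulrN.
move=> /(_ erefl) h1 /(_ erefl) h2.
apply: le_trans (lerB (lerB (lexx _) h1) h2).
rewrite exprSr le_eqVlt; apply/orP; left; apply/eqP; ring.
Qed.

(** Summed over the directions, the second differences give a main term
2 b d w^(b+1).  The error 2 d b 6^b w^(b+2) is at most half of it because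
w <= 1/A, and the error 8 b 6^b |n|^2 w^(b+2) is at most 8 b 6^b w^(b+1), which
a large [d] absorbs. *)
Lemma laplacian_weight_ge (n : lattice d) :
  d%:R / 2 * w n ^+ b.+1 <= real_laplacian (fun m => w m ^+ b) n.
Proof.
apply: le_trans (ler_sum _ (fun j _ => second_difference_weight j n)).
rewrite -mulr_sumr mulrC.
have w0 : 0 < w n := inv_weight_gt0 A_ge1 n.
apply: ler_wpM2l; first by rewrite exprn_ge0 ?ltW.
have wV : w n <= A^-1 := inv_weight_leV A_ge1 n.
rewrite sumrB sumr_const card_ord -mulr_suml -mulr_sumr big_split/=.
rewrite sumr_const card_ord -mulr_sumr -(mulr_natl 2 d) -(mulr_natl (2 * b%:R) d).
set r : R := \sum_(j < d) _.
have r0 : 0 <= r := sum_coord_sqr_ge0 R n.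
have A0 : 0 < A := lt_le_trans ltr01 A_ge1.
have rw : r * w n <= 1.
  by rewrite /w /inv_weight -/r ler_pdivrMr ?mul1r ?lerDr ?ltW// ltr_pwDl.
have Pw : 2 * (6 ^+ b * w n) <= 1.
  rewrite mulrA; apply: le_trans (ler_wpM2l _ wV) _; first by have := P1; lra.
  by rewrite ler_pdivrMr ?mul1r.
have b1 : 1 <= b%:R :> R by rewrite ler1n.
have d0 : 0 <= d%:R :> R by [].
have P0 := P1; move: d_ge.
have -> : b%:R * 6 ^+ b * (d%:R * 2 + 8 * r) * w n =
  b%:R * (d%:R * (2 * (6 ^+ b * w n)) + 8 * (6 ^+ b * (r * w n))) by ring.
move: P0 rw Pw; set P := 6 ^+ b; set y := r * w n; set z := 2 * _ => P0 rw Pw dge.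
have dz : d%:R * z <= d%:R by rewrite -[leRHS]mulr1 ler_wpM2l.
have Py : P * y <= P by rewrite -[leRHS]mulr1 ler_wpM2l//; lra.
apply: le_trans (_ : b%:R * (2 * d%:R - d%:R - 8 * P) <= _).
  apply: le_trans (_ : 1 * (2 * d%:R - d%:R - 8 * P) <= _); first by lra.
  by apply: ler_wpM2r; lra.
have -> : d%:R * (2 * b%:R) = b%:R * (2 * d%:R) :> R by ring.
by rewrite -mulrBr; apply: ler_wpM2l; lra.
Qed.

End Superharmonic.

(** * Weighted Hardy and Rellich inequalities *)

Section HardyRellich.
Variables (R : realType) (d : nat) (A : R).
Let w := inv_weight (d := d) A.

Lemma weighted_rellich b (f : lattice d -> R) :
  2 * 6 ^+ b.+1 <= A -> 16 * 6 ^+ b.+1 <= d%:R :> R ->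
  finitely_supported f ->
  d%:R ^+ 2 / 16 * lattice_sum (fun n => f n ^+ 2 * w n ^+ b.+2) <=
  lattice_sum (fun n => real_laplacian f n ^+ 2 * w n ^+ b).
Proof.
move=> A_ge d_ge ff.
have P1 : 1 <= 6 ^+ b.+1 :> R by rewrite exprn_ege1//; lra.
have A1 : 1 <= A by lra.
have d_gt0 : 0 < d%:R :> R by lra.
have f2 := finitely_supportedX 1 ff.
have fl2 := finitely_supportedX 1 (finitely_supported_laplacian ff).
set X := lattice_sum (fun n => f n ^+ 2 * w n ^+ b.+2).
set Y := lattice_sum _.
have low : d%:R / 2 * X <=
    lattice_sum (fun n => real_laplacian (fun m => f m ^+ 2) n * w n ^+ b.+1).
  rewrite lattice_sum_laplacianC// -lattice_sumZ; apply: le_lattice_sum.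
  - exact/finitely_supportedZ/finitely_supportedM.
  - exact: finitely_supportedM.
  move=> n; rewrite mulrCA; apply: ler_wpM2l; first exact: sqr_ge0.
  exact: laplacian_weight_ge.
(* The parameter d / 4 of the mean inequality is half the constant d / 2 in
   [low], which maximizes (d / 2) s - s^2. *)
have up : d%:R / 4 * lattice_sum (fun n =>
      real_laplacian (fun m => f m ^+ 2) n * w n ^+ b.+1) <=
    Y + (d%:R / 4) ^+ 2 * X.
  rewrite -!lattice_sumZ -lattice_sumD; last 2 first.
  - exact: finitely_supportedM.
  - exact/finitely_supportedZ/finitely_supportedM.
  apply: le_lattice_sum.
  - exact/finitely_supportedZ/finitely_supportedM/finitely_supported_laplacian.
  - apply: finitely_supportedD; first exact: finitely_supportedM.
    exact/finitely_supportedZ/finitely_supportedM.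
  move=> n; have w0 : 0 < w n := inv_weight_gt0 A1 n.
  have wb0 := ltW (exprn_gt0 b w0).
  rewrite !exprSr.
  have := laplacian_sqr_le f n.
  set L2 := real_laplacian _ n; set L := real_laplacian f n => L2_le.
  have : d%:R / 4 * (L2 * (w n ^+ b * w n)) <=
      d%:R / 4 * (2 * (f n * L) * (w n ^+ b * w n)).
    apply: ler_wpM2l; first by lra.
    by apply: ler_wpM2r => //; rewrite mulr_ge0// ltW.
  move=> /le_trans; apply; rewrite -subr_ge0.
  rewrite (_ : _ - _ = w n ^+ b * (L - d%:R / 4 * (f n * w n)) ^+ 2).
    by rewrite mulr_ge0// sqr_ge0.
  by field.
have : d%:R / 4 * (d%:R / 2 * X) <= Y + (d%:R / 4) ^+ 2 * X.
  by apply: le_trans up; apply: ler_wpM2l => //; lra.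
by lra.
Qed.

Lemma hardy (f : lattice d -> R) :
  12 <= A -> 96 <= d%:R :> R -> finitely_supported f ->
  d%:R / 2 * lattice_sum (fun n => f n ^+ 2 * w n) <= dirichlet_form f.
Proof.
move=> A_ge d_ge ff; have A1 : 1 <= A by lra.
have f2 := finitely_supportedX 1 ff.
apply: le_trans (hardy_ground_state ff (inv_weight_gt0 A1)).
rewrite -lattice_sumZ; apply: le_lattice_sum.
- exact/finitely_supportedZ/finitely_supportedM.
- exact: finitely_supportedM.
move=> n; rewrite mulrCA; apply: ler_wpM2l; first exact: sqr_ge0.
rewrite ler_pdivlMr ?inv_weight_gt0// -mulrA -expr2.
by apply: (@laplacian_weight_ge R d A 1); rewrite ?expr1//; lra.
Qed.

Lemma iterated_rellich k b (f : lattice d -> R) :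
  2 * 6 ^+ (2 * k + b) <= A -> 16 * 6 ^+ (2 * k + b) <= d%:R :> R ->
  finitely_supported f ->
  (d%:R ^+ 2 / 16) ^+ k * lattice_sum (fun n => f n ^+ 2 * w n ^+ (2 * k + b)) <=
  lattice_sum (fun n => iter k (@real_laplacian R d) f n ^+ 2 * w n ^+ b).
Proof.
have mono p q : (p <= q)%N -> 6 ^+ p <= 6 ^+ q :> R.
  by move=> pq; rewrite ler_weXn2l//; lra.
elim: k b => [|k IH] b A_ge d_ge ff; first by rewrite expr0 mul1r.
have E : (2 * k.+1 + b = 2 * k + b.+2)%N by lia.
have bE : 6 ^+ b.+1 <= 6 ^+ (2 * k.+1 + b) :> R by apply: mono; lia.
have A_ge' : 2 * 6 ^+ b.+1 <= A by apply: le_trans A_ge; rewrite ler_wpM2l.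
have d_ge' : 16 * 6 ^+ b.+1 <= d%:R :> R by apply: le_trans d_ge; rewrite ler_wpM2l.
have fk := finitely_supported_iter_laplacian k ff.
rewrite iterS; apply: le_trans (weighted_rellich A_ge' d_ge' fk).
rewrite exprS -mulrA; apply: ler_wpM2l; first by rewrite divr_ge0 ?sqr_ge0.
rewrite E; apply: IH; by rewrite -?E.
Qed.

End HardyRellich.

(** * The sharp constant *)

Section ComplexValued.
Variables (R : realType) (d : nat).
Implicit Types (u : lattice d -> R[i]) (f : lattice d -> R).

Lemma normc_sqr (z : R[i]) : normc z ^+ 2 = complex.Re z ^+ 2 + complex.Im z ^+ 2.
Proof. by case: z => a b; rewrite /normc sqr_sqrtr// addr_ge0 ?sqr_ge0. Qed.

Lemma Re_iter_laplacian k u :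
  @complex.Re R \o iter k (@laplacian R d) u =
  iter k (@real_laplacian R d) (@complex.Re R \o u).
Proof.
elim: k => //= k <-; apply/funext => n /=; rewrite /laplacian /real_laplacian.
rewrite (big_morph (@complex.Re R) (id1 := 0) (op1 := +%R))// => [|[? ?] [? ?]//].
apply: eq_bigr => j _ /=; rewrite !mulr2n.
by move: (iter k _ u n) (iter k _ u (n - _)) (iter k _ u (n + basis_vec j)) => [? ?] [? ?] [? ?].
Qed.

Lemma Im_iter_laplacian k u :
  @complex.Im R \o iter k (@laplacian R d) u =
  iter k (@real_laplacian R d) (@complex.Im R \o u).
Proof.
elim: k => //= k <-; apply/funext => n /=; rewrite /laplacian /real_laplacian.
rewrite (big_morph (@complex.Im R) (id1 := 0) (op1 := +%R))// => [|[? ?] [? ?]//].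
apply: eq_bigr => j _ /=; rewrite !mulr2n.
by move: (iter k _ u n) (iter k _ u (n - _)) (iter k _ u (n + basis_vec j)) => [? ?] [? ?] [? ?].
Qed.

Lemma finitely_supported_Re u : fin_supp u ->
  finitely_supported (@complex.Re R \o u).
Proof.
by apply: sub_finite_set => n /=; apply: contraNN => /eqP->.
Qed.

Lemma finitely_supported_Im u : fin_supp u ->
  finitely_supported (@complex.Im R \o u).
Proof.
by apply: sub_finite_set => n /=; apply: contraNN => /eqP->.
Qed.

Lemma energyE k u : fin_supp u -> energy k u =
  dirichlet_form (iter k (@real_laplacian R d) (@complex.Re R \o u)) +
  dirichlet_form (iter k (@real_laplacian R d) (@complex.Im R \o u)).
Proof.
move=> fu; rewrite -lattice_sumD; last 2 first.
- exact/finitely_supported_gradient/finitely_supported_iter_laplacian/finitely_supported_Re.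
- exact/finitely_supported_gradient/finitely_supported_iter_laplacian/finitely_supported_Im.
rewrite -Re_iter_laplacian -Im_iter_laplacian; apply: eq_lattice_sum => n.
rewrite -big_split; apply: eq_bigr => j _; rewrite normc_sqr/= /backward_diff.
by move: (iter k _ u n) (iter k _ u (n - _)) => [? ?] [? ?].
Qed.

Lemma lattice_sum_normc (a : lattice d -> R) u : fin_supp u ->
  lattice_sum (fun n => normc (u n) ^+ 2 * a n) =
  lattice_sum (fun n => (@complex.Re R \o u) n ^+ 2 * a n) +
  lattice_sum (fun n => (@complex.Im R \o u) n ^+ 2 * a n).
Proof.
move=> fu; rewrite -lattice_sumD.
- by apply: eq_lattice_sum => n; rewrite normc_sqr mulrDl.
- exact/finitely_supportedM/finitely_supportedX/finitely_supported_Re.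
- exact/finitely_supportedM/finitely_supportedX/finitely_supported_Im.
Qed.

Lemma iter_laplacian_sqr_le k f : finitely_supported f ->
  lattice_sum (fun n => iter k (@real_laplacian R d) f n ^+ 2) <=
  (16 * d%:R ^+ 2) ^+ k * lattice_sum (fun n => f n ^+ 2).
Proof.
move=> ff; elim: k => [|k IH]; first by rewrite expr0 mul1r.
have fk := finitely_supported_iter_laplacian k ff.
apply: le_trans (lattice_sum_laplacian_sqr_le fk) _.
by rewrite [in leRHS](exprS _ k) -[leRHS]mulrA ler_wpM2l// mulr_ge0// sqr_ge0.
Qed.

Lemma dirichlet_form_iter_laplacian_le k f : finitely_supported f ->
  dirichlet_form (iter k (@real_laplacian R d) f) <=
  4 * 16 ^+ k * d%:R ^+ (2 * k + 1) * lattice_sum (fun n => f n ^+ 2).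
Proof.
move=> ff; have fk := finitely_supported_iter_laplacian k ff.
apply: le_trans (dirichlet_form_le fk) _.
have -> : 4 * 16 ^+ k * d%:R ^+ (2 * k + 1) =
    4 * d%:R * (16 * d%:R ^+ 2) ^+ k :> R.
  by rewrite exprD expr1 exprMn exprM; ring.
by rewrite -[leRHS]mulrA ler_wpM2l ?mulr_ge0// iter_laplacian_sqr_le.
Qed.

Lemma eucl_norm_weight_le (A : R) p (n : lattice d) : 1 <= A -> n != 0 ->
  (1 + A) ^- p * (eucl_norm R n ^+ (2 * p))^-1 <= inv_weight A n ^+ p.
Proof.
move=> A_ge1 n0; rewrite exprM /eucl_norm sqr_sqrtr ?sum_coord_sqr_ge0//.
rewrite -!exprVn -exprMn; have /rV0Pn[j nj] := n0.
have r1 : 1 <= \sum_(i < d) (n 0 i)%:~R ^+ 2 :> R.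
  rewrite (bigD1 j)//=; apply: ler_wpDr.
    by apply: sumr_ge0 => i _; exact: sqr_ge0.
  rewrite -rmorphXn/= -[leLHS]/(1%:~R) ler_int.
  by rewrite -gtz0_ge1 exprn_even_gt0 ?nj.
rewrite /inv_weight; move: (\sum_(i < d) _) r1 => r r1.
have A0 : 0 < 1 + A by lra.
apply: lerXn2r; rewrite ?nnegrE.
- by rewrite mulr_ge0// invr_ge0; lra.
- by rewrite invr_ge0; lra.
rewrite -invfM lef_pV2 ?posrE ?mulr_gt0//; nra.
Qed.

Lemma hardy_rellich k (A : R) f : 2 * 6 ^+ (2 * k + 1) <= A ->
  16 * 6 ^+ (2 * k + 1) <= d%:R :> R -> finitely_supported f -> f 0 = 0 ->
  (2 * 16 ^+ k * (1 + A) ^+ (2 * k + 1))^-1 * d%:R ^+ (2 * k + 1) *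
    lattice_sum (fun n => f n ^+ 2 * (eucl_norm R n ^+ (4 * k + 2))^-1) <=
  dirichlet_form (iter k (@real_laplacian R d) f).
Proof.
move=> A_ge d_ge ff f0; have fk := finitely_supported_iter_laplacian k ff.
have six : 6 <= 6 ^+ (2 * k + 1) :> R.
  by rewrite -[leLHS]expr1 ler_weXn2l//; [lra | lia].
have A_ge12 : 12 <= A by apply: le_trans A_ge; lra.
have d_ge96 : 96 <= d%:R :> R by apply: le_trans d_ge; lra.
apply: le_trans (hardy A_ge12 d_ge96 fk).
have /= := iterated_rellich A_ge d_ge ff; under [in X in _ <= X]eq_lattice_sum.
  by move=> n; rewrite expr1; over.
set X := lattice_sum _; set Y := lattice_sum _; set Z := lattice_sum _ => XY.
have ZX : (1 + A) ^- (2 * k + 1) * Z <= X.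
  rewrite -lattice_sumZ; apply: le_lattice_sum.
  - exact/finitely_supportedZ/finitely_supportedM/finitely_supportedX.
  - exact/finitely_supportedM/finitely_supportedX.
  (* At n = 0 the weight [inv_weight A 0] is positive while 0^-1 = 0; both sides
     vanish because f 0 = 0. *)
  move=> n; have [->|n0] := eqVneq n 0; first by rewrite f0 expr0n !mul0r mulr0.
  rewrite mulrCA; apply: ler_wpM2l; first exact: sqr_ge0.
  rewrite (_ : (4 * k + 2 = 2 * (2 * k + 1))%N); last by lia.
  by apply: eucl_norm_weight_le => //; lra.
have d0 : 0 <= d%:R :> R by [].
apply: le_trans (ler_wpM2l _ XY); last by lra.
apply: le_trans (_ : d%:R / 2 * ((d%:R ^+ 2 / 16) ^+ k *
    ((1 + A) ^- (2 * k + 1) * Z)) <= _).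
  rewrite (exprD d%:R) exprM expr1 expr_div_n !invfM le_eqVlt.
  by apply/orP; left; apply/eqP; ring.
rewrite ler_wpM2l ?divr_ge0// ler_wpM2l// exprn_ge0// divr_ge0// exprn_ge0//.
Qed.

Lemma admissible_lower k (A : R) : 2 * 6 ^+ (2 * k + 1) <= A ->
  16 * 6 ^+ (2 * k + 1) <= d%:R :> R ->
  admissible k d ((2 * 16 ^+ k * (1 + A) ^+ (2 * k + 1))^-1 * d%:R ^+ (2 * k + 1)).
Proof.
move=> A_ge d_ge u fu u0; rewrite energyE// [weighted_sum _ _]lattice_sum_normc//.
rewrite mulrDr; apply: lerD; apply: hardy_rellich => //=; rewrite ?u0//.
- exact: finitely_supported_Re.
- exact: finitely_supported_Im.
Qed.

Lemma fin_supp_delta (v : lattice d) :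
  fin_supp (fun n => (n == v)%:R : R[i]).
Proof.
apply: (sub_finite_set _ (finite_set1 v)) => n /=.
by case: (n =P v) => // _; rewrite eqxx.
Qed.

Lemma energy_delta_le k (j : 'I_d) :
  energy k (fun n => (n == basis_vec j)%:R : R[i]) <=
  4 * 16 ^+ k * d%:R ^+ (2 * k + 1).
Proof.
set u := fun n => _; have fu : fin_supp u := fin_supp_delta _.
rewrite energyE//.
have fr := finitely_supported_Re fu; have fi := finitely_supported_Im fu.
apply: le_trans (lerD (dirichlet_form_iter_laplacian_le k fr)
  (dirichlet_form_iter_laplacian_le k fi)) _.
rewrite -mulrDr -lattice_sumD; [|exact: finitely_supportedX..].
rewrite /lattice_sum -(fsbig_widen [set basis_vec j] setT)//=.
  by rewrite fsbig_set1 /u eqxx/= expr1n expr0n addr0 mulr1.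
by move=> n [_ /= /eqP/negbTE nj]; rewrite /u nj/= expr0n addr0.
Qed.

End ComplexValued.

Theorem theorem1p1 (R : realType) (k : nat) :
  exists (c1 c2 : R) (N : nat),
    [/\ 0 < c1, 0 < c2 &
      forall d : nat, (0 < d)%N -> (N <= d)%N ->
        c1 * d%:R ^+ (2 * k + 1)%N <= sharp_constant R k d /\
        sharp_constant R k d <= c2 * d%:R ^+ (2 * k + 1)%N].
Proof.
pose A : R := 2 * 6 ^+ (2 * k + 1).
have A_gt0 : 0 < A by rewrite mulr_gt0// exprn_gt0.
exists (2 * 16 ^+ k * (1 + A) ^+ (2 * k + 1))^-1, (4 * 16 ^+ k).
exists (16 * 6 ^ (2 * k + 1))%N; split.
- by rewrite invr_gt0 !mulr_gt0// exprn_gt0// ltr_pwDl// ltW.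
- by rewrite mulr_gt0// exprn_gt0.
move=> d d_gt0 d_ge; have [adm maxi] := @sharp_constant_max R k d d_gt0; split.
  apply/maxi/admissible_lower; first exact: lexx.
  by rewrite -natrX -natrM ler_nat.
pose j := Ordinal d_gt0; apply: le_trans (energy_delta_le R k j).
have := adm (fun n => (n == basis_vec j)%:R); rewrite weighted_sum_delta mulr1.
apply; first exact: fin_supp_delta.
by case: (0 =P basis_vec j) => // /matrixP/(_ 0 j); rewrite !mxE !eqxx.
Qed.
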